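(* Consider the control system $\dot x(t)=f(x(t))+g(x(t))u(t)$ with $x\in\mathbb{R}^n$, $u\in U$, where $U\subseteq\mathbb{R}^m$ is compact and $f:\mathbb{R}^n\to\mathbb{R}^n$, $g:\mathbb{R}^n\to\mathbb{R}^{n\times m}$ are $r$-times continuously differentiable, $r\ge 1$. Let $h:\mathbb{R}^n\to\mathbb{R}$ be of relative-degree $r$ with respect to this system and let $S=\{x\in\mathbb{R}^n : h(x)\le 0\}$. Let $u^*:\mathbb{R}^n\to U$ be a control law such that: (A1) for every $x(0)\in S$, the closed-loop system $\dot x=f(x)+g(x)u^*(x)$ admits a unique solution $x(t)$, $t\ge 0$; (A2) for every $x\in S$, the quantity $$H(x)=\sup_{t\ge 0}\psi_h(t;x,u^* )$$ exists and is finite, and $H$ is differentiable at $x$. Let $S_H=\{x\in\mathbb{R}^n : H(x)\le 0\}$ and assume $S_H\neq\emptyset$. Then $H$ is a zeroing control barrier function on $S_H$ for the control set $U$; that is, there exists an extended class-$\mathcal{K}$ function $\alpha$ such that $$\inf_{u\in U}\left[L_fH(x)+L_gH(x)\,u-\alpha(-H(x))\right]\le 0\qquad\text{for all }x\in S_H .$$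
   Context: Lie derivatives: for a real-valued function $\phi$ on $\mathbb{R}^n$ differentiable at $x$, $L_f\phi(x)=\frac{\partial \phi}{\partial x}(x)f(x)\in\mathbb{R}$ and $L_g\phi(x)=\frac{\partial\phi}{\partial x}(x)g(x)\in\mathbb{R}^{1\times m}$; $L_f^0\phi=\phi$, $L_f^{k}\phi=L_f(L_f^{k-1}\phi)$. Relative degree: $h:\mathbb{R}^n\to\mathbb{R}$ is of relative-degree $r$ with respect to the system if (1) $h$ is $r$-times continuously differentiable; (2) $L_gL_f^kh(x)=0$ for all $x\in\mathbb{R}^n$ and all $k=0,1,\dots,r-2$ (vacuous if $r=1$); (3) there is a nonempty set $C\subseteq\mathbb{R}^n$ such that $L_gL_f^{r-1}h(x)\ne 0$ for all $x\in C$. Extended class-$\mathcal{K}$: $\alpha:\mathbb{R}\to\mathbb{R}$ that is strictly increasing with $\alpha(0)=0$. Flow: for a control law $u^*$, let $y(t)$, $t\ge0$, be the solution of $\dot y=f(y)+g(y)u^*(y)$, $y(0)=x$; then $\psi_h(t;x,u^* )=h(y(t))$. ''Solution'' means a locally absolutely continuous function satisfying the ODE for almost every $t\ge 0$. $H(x)$ is defined at those $x$ for which this solution exists uniquely for all $t\ge 0$ and the supremum is finite; differentiability of $H$ at $x\in S$ includes the requirement that $H$ is defined in a neighbourhood of $x$. Taking $t=0$ in the supremum gives $H\ge h$, so $S_H\subseteq S$. *)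

(* Defs.v *)
From HB Require Import structures.
From mathcomp Require Import all_boot all_order all_algebra.
From mathcomp Require Import all_classical all_reals all_analysis.
Set Implicit Arguments.
Unset Strict Implicit.
Unset Printing Implicit Defensive.
Import Order.TTheory GRing.Theory Num.Theory.
Import numFieldNormedType.Exports.
Local Open Scope classical_set_scope.
Local Open Scope ring_scope.

(* C^k through iterated directional derivatives: in finite dimension this is
   the usual class of k-times continuously differentiable maps. *)
Fixpoint Ck (R : realType) (V W : normedModType R) (k : nat) (F : V -> W) :
    Prop :=
  if k is k'.+1 then
    (forall x, differentiable F x) /\ (forall v, Ck k' (fun x => 'D_v F x))
  else continuous F.

Section Lie.
Context {R : realType} {n m : nat}.
Implicit Types (f : 'cV[R]_n -> 'cV[R]_n) (g : 'cV[R]_n -> 'M[R]_(n, m))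
  (phi : 'cV[R]_n -> R).

Definition gradient phi (x : 'cV[R]_n) : 'rV[R]_n :=
  \row_i 'd phi x (delta_mx i 0).

Definition Lf f phi (x : 'cV[R]_n) : R := (gradient phi x *m f x) 0 0.

Definition Lg g phi (x : 'cV[R]_n) : 'rV[R]_m := gradient phi x *m g x.

Definition Lfk f (k : nat) phi : 'cV[R]_n -> R := iter k (Lf f) phi.

Definition relative_degree f g (r : nat) (h : 'cV[R]_n -> R) : Prop :=
  [/\ Ck r h,
      forall (x : 'cV[R]_n) (k : nat), (k.+2 <= r)%N -> Lg g (Lfk f k h) x = 0
    & exists2 C : set 'cV[R]_n, C !=set0 &
        forall x, C x -> Lg g (Lfk f r.-1 h) x != 0].

End Lie.

Definition extended_classK (R : realType) (alpha : R -> R) : Prop :=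
  {homo alpha : s t / s < t} /\ alpha 0 = 0.

Definition abs_continuous (R : realType) (V : normedModType R) (a b : R)
    (y : R -> V) : Prop :=
  forall eps : R, 0 < eps -> exists2 delta : R, 0 < delta &
    forall (N : nat) (s t : 'I_N -> R),
      (forall i, a <= s i /\ s i <= t i /\ t i <= b) ->
      trivIset setT (fun i => [set` `]s i, t i[%R]) ->
      \sum_(i < N) (t i - s i) < delta ->
      \sum_(i < N) `|y (t i) - y (s i)| < eps.

Section Flow.
Context {R : realType} {n : nat}.
Implicit Types (F : 'cV[R]_n -> 'cV[R]_n) (x : 'cV[R]_n) (y z : R -> 'cV[R]_n).

(* Only the restriction of y to [0, +oo[ matters: the two-sided derivative
   at t = 0 is irrelevant because {0} is negligible. *)
Definition is_solution F x y : Prop :=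
  [/\ y 0 = x,
      forall T : R, 0 < T -> abs_continuous 0 T y
    & {ae (@lebesgue_measure R), forall t : R,
         0 <= t -> is_derive t (1 : R) y (F (y t))}].

Definition has_unique_solution F x : Prop :=
  exists2 y, is_solution F x y &
    forall z, is_solution F x z -> forall t, 0 <= t -> z t = y t.

(* The solution from x, with the constant x as default value when there is
   none. *)
Definition flow F x : R -> 'cV[R]_n :=
  xget (fun=> x) [set y | is_solution F x y].

Definition psi (h : 'cV[R]_n -> R) F (t : R) x : R := h (flow F x t).

Definition psi_values (h : 'cV[R]_n -> R) F x : set R :=
  [set psi h F t x | t in [set t | 0 <= t]].

(* H is a partial function: it is encoded by the total function Hfun together
   with its domain Hdom, outside of which the value of Hfun is meaningless. *)
Definition Hfun (h : 'cV[R]_n -> R) F x : R := sup (psi_values h F x).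

Definition Hdom (h : 'cV[R]_n -> R) F : set 'cV[R]_n :=
  [set x | has_unique_solution F x /\ has_sup (psi_values h F x)].

Definition H_differentiable (h : 'cV[R]_n -> R) F x : Prop :=
  (\forall x' \near x, Hdom h F x') /\ differentiable (Hfun h F) x.

Definition SH (h : 'cV[R]_n -> R) F : set 'cV[R]_n :=
  [set x | Hdom h F x /\ Hfun h F x <= 0].

End Flow.

Definition closed_loop (R : realType) (n m : nat) (f : 'cV[R]_n -> 'cV[R]_n)
    (g : 'cV[R]_n -> 'M[R]_(n, m)) (u : 'cV[R]_n -> 'cV[R]_m) :
    'cV[R]_n -> 'cV[R]_n :=
  fun x => f x + g x *m u x.

(* The infimum is taken in the extended reals, where it always exists. *)
Definition zeroing_CBF (R : realType) (n m : nat) (f : 'cV[R]_n -> 'cV[R]_n)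
    (g : 'cV[R]_n -> 'M[R]_(n, m)) (U : set 'cV[R]_m) (C : set 'cV[R]_n)
    (H : 'cV[R]_n -> R) : Prop :=
  exists2 alpha : R -> R, extended_classK alpha &
    forall x, C x ->
      (ereal_inf [set (Lf f H x + (Lg g H x *m u) 0 0 - alpha (- H x))%:E
                 | u in U] <= 0)%E.

(* Main.v *)
(** With alpha the identity, it suffices to find at every x with H x <= 0
    controls in U along which dH(x) is at most an arbitrarily small positive
    number. By uniqueness of solutions, H is at most H x along the closed-loop
    trajectory y from x. As u* need not be continuous, y may fail to be
    differentiable at 0, and f(x) + g(x) u*(x) need not be its velocity there.
    But if dH(x) (f(x) + g(x) u) >= c > 0 for all u in U, then by compactness
    dH(x) (f(z) + g(z) u) >= c / 2 for all z near x and all u in U, so that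
    dH(x) y' >= c / 2 almost everywhere near 0. A mean value inequality for
    absolutely continuous curves turns this into H (y t) > H x for small t > 0,
    a contradiction. *)

Require Import Defs.
From mathcomp Require Import all_boot all_order all_algebra.
From mathcomp Require Import all_classical all_reals all_analysis.
From mathcomp Require Import measurable_realfun lra.
Set Implicit Arguments.
Unset Strict Implicit.
Unset Printing Implicit Defensive.
Import Order.TTheory GRing.Theory Num.Theory.
Import numFieldNormedType.Exports.
Local Open Scope classical_set_scope.
Local Open Scope ring_scope.

Section interval_chains.
Context {R : realType}.
Implicit Types (u v w : R) (s : seq (R * R)).

Definition itv_chain u v s : bool :=
  all (fun i => [&& u <= i.1, i.1 <= i.2 & i.2 <= v]) s &&
  pairwise (fun i j => i.2 <= j.1) s.

Lemma itv_chain_cat u v w s1 s2 : u <= v -> v <= w ->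
  itv_chain u v s1 -> itv_chain v w s2 -> itv_chain u w (s1 ++ s2).
Proof.
move=> uv vw /andP[/allP s1_uv s1_lt] /andP[/allP s2_vw s2_lt].
rewrite /itv_chain all_cat pairwise_cat s1_lt s2_lt !andbT -andbA.
apply/and3P; split.
- apply/allP => i /s1_uv /and3P[-> -> iv] /=; exact: le_trans vw.
- apply/allP => i /s2_vw /and3P[vi -> ->]; rewrite !andbT.
  exact: le_trans uv vi.
- apply/allrelP => i j /s1_uv /and3P[_ _ iv] /s2_vw /and3P[vj _ _].
  exact: le_trans iv vj.
Qed.

Lemma itv_chain_trivIset u v s : itv_chain u v s ->
  trivIset setT (fun k : 'I_(size s) => `](s`_k).1, (s`_k).2[%classic).
Proof.
move=> /andP[_ /(pairwiseP 0) s_lt].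
have disj (j k : 'I_(size s)) z : (j < k)%N ->
    `](s`_j).1, (s`_j).2[%classic z -> `](s`_k).1, (s`_k).2[%classic z -> False.
  move=> jk /=; rewrite !in_itv /= => /andP[_ zj] /andP[kz _].
  have := s_lt j k (ltn_ord j) (ltn_ord k) jk; lra.
move=> j k _ _ [z [zj zk]]; case: (ltngtP j k) => [jk|kj|]; last exact: val_inj.
- by case: (disj j k z).
- by case: (disj k j z).
Qed.

Lemma itv_chain_measure_le u v s (G : set R) : measurable G ->
  itv_chain u v s -> (forall i, i \in s -> `]i.1, i.2[ `<=` G) ->
  ((\sum_(i <- s) (i.2 - i.1))%:E <= @lebesgue_measure R G)%E.
Proof.
move=> mG s_chain sG.
pose I (k : 'I_(size s)) : set (measurableTypeR R) :=
  `](s`_k).1, (s`_k).2[%classic.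
have mI k : measurable (I k) by exact: measurable_itv.
have muI (k : 'I_(size s)) :
    ((s`_k).2 - (s`_k).1)%:E = @lebesgue_measure R (I k).
  have /andP[/all_nthP s_uv _] := s_chain.
  have /and3P[_ ik _] := s_uv 0 k (ltn_ord k).
  rewrite /I lebesgue_measure_itv /= lte_fin; case: ltP => // ki.
  by congr EFin; lra.
rewrite (big_nth 0) big_mkord -sumEFin.
under eq_bigr do rewrite muI.
rewrite -(measure_bigsetU_ord lebesgue_measure xpredT mI);
  last exact: itv_chain_trivIset s_chain.
apply: le_measure; rewrite ?inE //; first exact: bigsetU_measurable.
by rewrite -bigcup_seq => z [k _]; apply: (sG s`_k); exact: mem_nth.
Qed.

Lemma abs_continuous_itv_chain (V : normedModType R) (a b : R) (y : R -> V) :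
  abs_continuous a b y -> forall e : R, 0 < e -> exists2 d : R, 0 < d &
    forall s, itv_chain a b s -> \sum_(i <- s) (i.2 - i.1) < d ->
      \sum_(i <- s) `|y i.2 - y i.1| < e.
Proof.
move=> yac e e0; have [d d0 yd] := yac e e0; exists d => // s s_chain.
rewrite (big_nth 0) big_mkord => sd; rewrite (big_nth 0) big_mkord.
apply: (yd (size s) (fun k => (s`_k).1) (fun k => (s`_k).2)) => //.
- move=> k; have /andP[/all_nthP s_ab _] := s_chain.
  by have /and3P[] := s_ab 0 k (ltn_ord k).
- exact: itv_chain_trivIset s_chain.
Qed.

End interval_chains.

Section subadditive_interval_functions.
Context {R : realType}.
Implicit Types (a b t u v w : R) (P : R -> R -> Prop) (phi : R -> R -> R).

Definition near_straddling a b t P : Prop :=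
  exists2 d : R, 0 < d & forall u v, a <= u -> v <= b ->
    t - d < u <= t -> t <= v < t + d -> P u v.

Lemma cousin_induction a b P : a <= b ->
  (forall u v w, a <= u -> u <= v -> v <= w -> w <= b ->
    P u v -> P v w -> P u w) ->
  (forall t, a <= t <= b -> near_straddling a b t P) ->
  P a b.
Proof.
move=> ab P_trans P_near.
pose A := [set t | a <= t <= b /\ P a t].
have Aa : A a.
  have [|d d0 Pd] := P_near a; first by rewrite lexx.
  by split; [rewrite lexx | apply: Pd => //; lra].
have Aub : has_ubound A by exists b => t [/andP[]].
pose s := sup A.
have as_ : a <= s by exact: ub_le_sup.
have sb : s <= b by apply: ge_sup; [exists a | move=> t [/andP[]]].
have [|d d0 Pd] := P_near s; first by rewrite as_.
have [t [/andP[at_ tb] Pat] std] : exists2 t, A t & s - d < t.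
  by apply: sup_adherent => //; split; first exists a.
have ts : t <= s by apply: ub_le_sup => //; split => //; rewrite at_.
have Pext v : s <= v -> v <= b -> v < s + d -> P a v.
  move=> sv vb vd; apply: (P_trans a t v) => //; first lra.
  by apply: Pd => //; apply/andP.
have [sb'|bs] := ltP s b; last by apply: Pext => //; lra.
pose v := Num.min b (s + d / 2).
have vb : v <= b by rewrite ge_min lexx.
have vd : v <= s + d / 2 by rewrite ge_min lexx orbT.
have sv : s < v by rewrite lt_min sb' /=; lra.
have : v <= s; last by lra.
apply: ub_le_sup => //; split; first by apply/andP; lra.
by apply: Pext => //; lra.
Qed.

Definition itv_subadditive a b phi : Prop :=
  forall u v w, a <= u -> u <= v -> v <= w -> w <= b ->
    phi u w <= phi u v + phi v w.

Lemma itv_subadditive_le_chain a b phi (G : set R) : a <= b ->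
  itv_subadditive a b phi -> open G ->
  (forall t, a <= t <= b -> ~ G t ->
    near_straddling a b t (fun u v => phi u v <= 0)) ->
  exists s, [/\ itv_chain a b s, forall i, i \in s -> `]i.1, i.2[ `<=` G &
    phi a b <= \sum_(i <- s) phi i.1 i.2].
Proof.
move=> ab phiD oG phi_le0.
apply: (cousin_induction (P := fun u v => exists s, [/\ itv_chain u v s,
  forall i, i \in s -> `]i.1, i.2[ `<=` G &
  phi u v <= \sum_(i <- s) phi i.1 i.2]) ab).
  move=> u v w au uv vw wb [s1 [c1 G1 le1]] [s2 [c2 G2 le2]].
  exists (s1 ++ s2); split; first exact: itv_chain_cat c1 c2.
    by move=> i; rewrite mem_cat => /orP[/G1|/G2].
  by rewrite big_cat; apply: le_trans (phiD u v w au uv vw wb) (lerD le1 le2).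
move=> t t_ab; have [Gt|nGt] := pselect (G t); last first.
  have [d d0 phid] := phi_le0 t t_ab nGt.
  exists d => // u v au vb ut tv; exists [::]; split => //.
  by rewrite big_nil; exact: phid.
have /nbhs_ballP[r /= r0 rG] : nbhs t G by exact: open_nbhs_nbhs.
exists r => // u v au vb /andP[tu ut] /andP[tv vt].
exists [:: (u, v)]; split; last by rewrite big_seq1.
  by rewrite /itv_chain /= !lexx (le_trans ut tv).
move=> i; rewrite inE => /eqP -> z /=; rewrite in_itv /= => /andP[uz zv].
by apply: rG; rewrite /ball /= ltr_norml; apply/andP; lra.
Qed.

(* Cover the exceptional null set by an open set of small measure: near every
   other point phi is nonpositive, and a chain inside that set is short. *)
Lemma ae_itv_subadditive_le0 a b phi : a <= b -> itv_subadditive a b phi ->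
  (forall e : R, 0 < e -> exists2 d : R, 0 < d &
    forall s, itv_chain a b s -> \sum_(i <- s) (i.2 - i.1) < d ->
      \sum_(i <- s) phi i.1 i.2 <= e) ->
  {ae (@lebesgue_measure R), forall t, a <= t <= b ->
    near_straddling a b t (fun u v => phi u v <= 0)} ->
  phi a b <= 0.
Proof.
move=> ab phiD phi_ac phi_le0; apply/ler_addgt0Pr => e e0; rewrite add0r.
have [d d0 phid] := phi_ac e e0.
move/negligible_outer_measure: phi_le0 => N0.
have [G [oG NG]] := outer_measure_open_le (~` [set t | a <= t <= b ->
  near_straddling a b t (fun u v => phi u v <= 0)]) (divr_gt0 d0 (@ltr0Sn _ 1)).
rewrite N0 add0e => G_small.
have [|s [s_chain sG phi_le]] := itv_subadditive_le_chain ab phiD oG.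
  by move=> t t_ab nGt; apply: contrapT => ?; apply/nGt/NG => /(_ t_ab).
apply: (le_trans phi_le); apply: phid => //.
have := le_trans (itv_chain_measure_le (open_measurable oG) s_chain sG) G_small.
by rewrite lee_fin; lra.
Qed.

End subadditive_interval_functions.

Lemma ae_subset d (T : ringOfSetsType d) (R : realType)
    (mu : {measure set T -> \bar R}) (P Q : set T) : P `<=` Q ->
  {ae mu, forall x, P x} -> {ae mu, forall x, Q x}.
Proof. by move=> PQ Pae; exact: filterS PQ Pae. Qed.

Lemma differentiable_near_expansion (R : realType) (V W : normedModType R)
    (F : V -> W) (x : V) (e : R) : differentiable F x -> 0 < e ->
  \forall z \near x, `|F z - F x - 'd F x (z - x)| <= e * `|z - x|.
Proof.
move=> /diff_locally /eqaddoP Fx e0.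
rewrite (near_shift 0); apply: filterS (Fx e e0) => z /=.
by rewrite !fctE /= !subr0 addrK opprD addrA.
Qed.

Lemma is_derive_straddle (R : realType) (V : normedModType R) (y : R -> V)
    (t e : R) (v : V) : is_derive t (1 : R) y v -> 0 < e ->
  exists2 d : R, 0 < d & forall t1 t2, t - d < t1 <= t -> t <= t2 < t + d ->
    `|y t2 - y t1 - (t2 - t1) *: v| <= e * (t2 - t1).
Proof.
move=> [dy vE] e0; have {}dy : differentiable y t by exact/derivable1_diffP.
have /nbhs_ballP[d /= d0 y_t] := differentiable_near_expansion dy e0.
exists d => // t1 t2 /andP[dt1 t1t] /andP[tt2 t2d].
have {}y_t s : `|t - s| < d -> `|y s - y t - (s - t) *: v| <= e * `|t - s|.
  by move=> /y_t; rewrite diff1E // derive1E vE [`|s - t|]distrC.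
have y_t1 : `|y t1 - y t - (t1 - t) *: v| <= e * (t - t1).
  by have := y_t t1; rewrite ger0_norm ?subr_ge0 //; apply; lra.
have y_t2 : `|y t2 - y t - (t2 - t) *: v| <= e * (t2 - t).
  by have := y_t t2; rewrite ler0_norm ?subr_le0 // opprB; apply; lra.
have -> : y t2 - y t1 - (t2 - t1) *: v =
    (y t2 - y t - (t2 - t) *: v) - (y t1 - y t - (t1 - t) *: v).
  by rewrite opprD addrACA -opprD -scalerBl !opprB !subrKA.
rewrite (le_trans (ler_normB _ _)) // (le_trans (lerD y_t2 y_t1)) //.
by rewrite -mulrDr addrA subrK.
Qed.

Section sublinear_functionals.
Context {R : realType} {V : normedModType R}.

Definition sublinear (p : V -> R) : Prop :=
  (forall v w, p (v + w) <= p v + p w) /\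
  (forall (k : R) v, 0 <= k -> p (k *: v) = k * p v).

Lemma sublinear_norm : sublinear (fun v => `|v|).
Proof.
by split=> [|k v k0]; [exact: ler_normD | rewrite normrZ ger0_norm].
Qed.

Lemma sublinear_linear (l : {linear V -> R}) : sublinear l.
Proof. by split=> [v w|k v _]; [rewrite linearD | rewrite linearZ]. Qed.

End sublinear_functionals.

Section sublinear_mean_value_inequality.
Context {R : realType} {V : normedModType R}.
Variables (p : V -> R) (K : R).
Hypotheses (p_sublinear : sublinear p) (K0 : 0 < K).
Hypothesis pK : forall v, p v <= K * `|v|.
Implicit Types (a b c e t : R) (y : R -> V).

Lemma is_derive_sublinear_le a b c e t y v :
  is_derive t (1 : R) y v -> p v <= c -> 0 < e ->
  near_straddling a b t
    (fun t1 t2 => p (y t2 - y t1) <= (c + e) * (t2 - t1)).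
Proof.
case: p_sublinear => pD pZ yv pv e0.
have [d d0 yd] := is_derive_straddle yv (divr_gt0 e0 K0).
exists d => // t1 t2 _ _ t1t tt2.
have t12 : 0 <= t2 - t1 by case/andP: t1t => _; case/andP: tt2; lra.
have p_main : p ((t2 - t1) *: v) <= c * (t2 - t1).
  by rewrite pZ // mulrC ler_wpM2r.
have p_rest : p (y t2 - y t1 - (t2 - t1) *: v) <= e * (t2 - t1).
  by rewrite (le_trans (pK _)) // mulrC -ler_pdivlMr // mulrAC yd.
have := pD (y t2 - y t1 - (t2 - t1) *: v) ((t2 - t1) *: v).
by rewrite subrK; lra.
Qed.

Lemma abs_continuous_sublinear_chain a b c e y : abs_continuous a b y ->
  0 < e -> exists2 d : R, 0 < d &
    forall s, itv_chain a b s -> \sum_(i <- s) (i.2 - i.1) < d ->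
      \sum_(i <- s) (p (y i.2 - y i.1) - c * (i.2 - i.1)) <= e.
Proof.
move=> yac e0; have cK : 0 < K + `|c| by rewrite ltr_wpDr.
have [d d0 yd] := abs_continuous_itv_chain yac (divr_gt0 e0 cK).
exists (Num.min d (e / (K + `|c|))); first by rewrite lt_min d0 divr_gt0.
move=> s s_chain; rewrite lt_min => /andP[/(yd _ s_chain) sy sd].
apply: (@le_trans _ _ (\sum_(i <- s)
    (K * `|y i.2 - y i.1| + `|c| * (i.2 - i.1)))).
  have /andP[/allP s_ab _] := s_chain.
  rewrite big_seq [leRHS]big_seq; apply: ler_sum => i /s_ab /and3P[_ i12 _].
  by rewrite lerD // -mulNr ler_wpM2r ?subr_ge0 // -normrN ler_norm.
have -> : e = K * (e / (K + `|c|)) + `|c| * (e / (K + `|c|)).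
  by rewrite -mulrDl mulrC divfK // gt_eqF.
by rewrite big_split /= -!mulr_sumr lerD // ler_wpM2l // ltW.
Qed.

Lemma abs_continuous_sublinear_le a b c y : a <= b -> abs_continuous a b y ->
  {ae (@lebesgue_measure R), forall t, a <= t <= b ->
    exists2 v, is_derive t (1 : R) y v & p v <= c} ->
  p (y b - y a) <= c * (b - a).
Proof.
have [pD _] := p_sublinear.
move=> ab yac y'c; apply/ler_addgt0Pr => e e0.
have r0 : 0 < e / (b - a + 1) by rewrite divr_gt0 // ltr_wpDl // subr_ge0.
apply: (@le_trans _ _ ((c + e / (b - a + 1)) * (b - a))); last first.
  rewrite mulrDl lerD2l mulrAC ler_pdivrMr ?ltr_wpDl ?subr_ge0 //.
  by rewrite ler_pM2l // lerDl.
rewrite -subr_le0.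
apply: (ae_itv_subadditive_le0 (phi := fun u v =>
  p (y v - y u) - (c + e / (b - a + 1)) * (v - u)) ab).
- move=> u v w _ _ _ _; have := pD (y w - y v) (y v - y u).
  by rewrite subrKA; lra.
- by move=> e1; exact: abs_continuous_sublinear_chain.
- apply: ae_subset y'c => t y'c /y'c[v yv pv].
  have [d d0 yd] := is_derive_sublinear_le a b yv pv r0.
  by exists d => // t1 t2 *; rewrite subr_le0 yd.
Qed.

End sublinear_mean_value_inequality.

Lemma abs_continuousS (R : realType) (V : normedModType R) (a b a' b' : R)
    (y : R -> V) : a' <= a -> b <= b' ->
  abs_continuous a' b' y -> abs_continuous a b y.
Proof.
move=> a'a bb' yac e e0; have [d d0 yd] := yac e e0.
exists d => // N s t st; apply: yd => i; have [as_ [st' tb]] := st i.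
by split; [exact: le_trans as_|split; [|exact: le_trans bb']].
Qed.

Lemma abs_continuous_near_right (R : realType) (V : normedModType R) (a b : R)
    (y : R -> V) (A : set V) : a < b -> abs_continuous a b y ->
  nbhs (y a) A -> \forall c \near a^'+, forall t, a <= t <= c -> A (y t).
Proof.
move=> ab yac /nbhs_normP[e /= e0 eA]; have [d d0 yd] := yac e e0.
near=> c => t /andP[at_ tc]; apply: eA; rewrite /= distrC.
have cb : c <= b by near: c; exact: nbhs_right_le.
have cd : c < a + d by near: c; apply: nbhs_right_lt; rewrite ltrDl.
have := yd 1%N (fun=> a) (fun=> t); rewrite !big_ord1; apply.
- by move=> _; rewrite lexx at_ (le_trans tc).
- by move=> i j _ _ _; rewrite !ord1.
- by rewrite ltrBlDl (le_lt_trans tc).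
Unshelve. all: by end_near. Qed.

Lemma linear_continuous_bound (R : realType) (V W : normedModType R)
    (l : {linear V -> W}) : continuous l ->
  exists2 K : R, 0 < K & forall v, `|l v| <= K * `|v|.
Proof.
by move=> l_cont; apply/pinfty_ex_gt0/linear_boundedP/linear_bounded_continuous.
Qed.

Lemma differentiable_lt_along_curve (R : realType) (V : normedModType R)
    (F : V -> R) (y : R -> V) (a b c M : R) :
  a < b -> abs_continuous a b y -> differentiable F (y a) -> 0 < c ->
  {ae (@lebesgue_measure R), forall t, a <= t <= b ->
    exists2 v, is_derive t (1 : R) y v & `|v| <= M /\ c <= 'd F (y a) v} ->
  \forall t \near a^'+, F (y a) < F (y t).
Proof.
move=> ab yac dF c0 y'.
have [K K0 dFK] := linear_continuous_bound (diff_continuous dF).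
have M1 : 0 < `|M| + 1 by rewrite ltr_wpDl.
near=> t.
have at_ : a < t by [].
have tb : t <= b by near: t; exact: nbhs_right_le.
have yact : abs_continuous a t y by exact: (abs_continuousS (lexx a) tb yac).
have y't : {ae (@lebesgue_measure R), forall s, a <= s <= t ->
    exists2 v, is_derive s (1 : R) y v & `|v| <= M /\ c <= 'd F (y a) v}.
  apply: ae_subset y' => s y's /andP[as_ st]; apply: y's.
  by rewrite as_ (le_trans st).
have y_lip : `|y t - y a| <= M * (t - a).
  apply: (abs_continuous_sublinear_le sublinear_norm ltr01 _ (ltW at_) yact).
    by move=> v; rewrite mul1r.
  by apply: ae_subset y't => s y's /y's[v yv [vM _]]; exists v.
have dF_ge : c * (t - a) <= 'd F (y a) (y t - y a).
  have := abs_continuous_sublinear_le (c := - c)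
    (sublinear_linear (-%R \o 'd F (y a))) K0 _ (ltW at_) yact.
  rewrite /= mulNr lerN2; apply.
    by move=> v; rewrite (le_trans (ler_norm _)) ?normrN.
  by apply: ae_subset y't => s y's /y's[v yv [_ cv]]; exists v; rewrite ?lerN2.
have F_err : c / (`|M| + 1) * `|y t - y a| < c * (t - a).
  rewrite mulrAC ltr_pdivrMr // -mulrA ltr_pM2l //.
  apply: (le_lt_trans y_lip).
  by rewrite mulrC ltr_pM2l ?subr_gt0 // (le_lt_trans (ler_norm M)) // ltrDl.
have F_exp : forall s, a <= s <= t ->
    `|F (y s) - F (y a) - 'd F (y a) (y s - y a)| <=
    c / (`|M| + 1) * `|y s - y a|.
  near: t.
  have := differentiable_near_expansion dF (divr_gt0 c0 M1).
  by move/(abs_continuous_near_right ab yac).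
have := F_exp t; rewrite lexx ltW // => /(_ isT).
by rewrite ler_norml => /andP[F_ge _]; lra.
Unshelve. all: by end_near. Qed.

Lemma near_compact_forall (X Y : topologicalType) (K : set Y) (x : X)
    (P : X -> Y -> Prop) : compact K ->
  (forall k, K k -> \forall xk \near (x, k), P xk.1 xk.2) ->
  \forall z \near x, forall k, K k -> P z k.
Proof.
move=> /compact_near_coveringP K_cover xP.
apply: (K_cover X (nbhs x) P) => k /xP.
move=> [[A B] /= [Ax Bk] AB]; exists (B, A) => //.
by move=> [k' z] [/= Bk' Az]; exact: (AB (z, k')).
Qed.

Lemma near_compact_lt (R : realType) (X Y : topologicalType)
    (phi : X * Y -> R) (K : set Y) (x : X) (c : R) :
  continuous phi -> compact K -> (forall k, K k -> phi (x, k) < c) ->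
  \forall z \near x, forall k, K k -> phi (z, k) < c.
Proof.
move=> phi_cont K_compact phi_lt; apply: near_compact_forall => // k Kk.
near=> xk; rewrite -surjective_pairing; near: xk.
exact: (cvgr_lt _ (phi_cont (x, k)) _ (phi_lt k Kk)).
Unshelve. all: by end_near. Qed.

Lemma near_compact_bounded (R : realType) (X Y : topologicalType)
    (W : normedModType R) (Phi : X * Y -> W) (K : set Y) (x : X) :
  continuous Phi -> compact K ->
  exists M : R, \forall z \near x, forall k, K k -> `|Phi (z, k)| < M.
Proof.
move=> Phi_cont K_compact.
have : compact [set Phi (x, k) | k in K].
  apply: continuous_compact => //; apply: continuous_subspaceT => k.
  apply: continuous_comp; last exact: Phi_cont.
  by apply: cvg_pair; [exact: cvg_cst | exact: cvg_id].
move=> /compact_bounded/pinfty_ex_gt0[M _ M_ge]; exists (M + 1).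
apply: (near_compact_lt (phi := Num.norm \o Phi)) => // [xk|k Kk].
  exact/continuous_comp/norm_continuous/Phi_cont.
by rewrite (@le_lt_trans _ _ M) ?ltrDl // M_ge //; exists k.
Qed.

Lemma exists_descent_velocity (R : realType) (V : normedModType R)
    (W : topologicalType) (Phi : V * W -> V) (U : set W) (F : V -> R) (x : V)
    (y : R -> V) (T c : R) :
  continuous Phi -> compact U -> differentiable F x ->
  0 < T -> y 0 = x -> abs_continuous 0 T y ->
  {ae (@lebesgue_measure R), forall t, 0 <= t <= T ->
    exists2 u, U u & is_derive t (1 : R) y (Phi (y t, u))} ->
  (forall t, 0 <= t <= T -> F (y t) <= F x) -> 0 < c ->
  exists2 u, U u & 'd F x (Phi (x, u)) < c.
Proof.
move=> Phi_cont U_compact dF T0 y0; rewrite -{x}y0 in dF *.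
move=> yac y' F_le c0.
apply: contrapT => no_descent.
have dF_ge u : U u -> c <= 'd F (y 0) (Phi (y 0, u)).
  by move=> Uu; rewrite leNgt; apply/negP => ?; apply: no_descent; exists u.
have [M Phi_lt] := near_compact_bounded (y 0) Phi_cont U_compact.
have dF_gt : \forall z \near y 0, forall u, U u ->
    - 'd F (y 0) (Phi (z, u)) < - (c / 2).
  apply: (near_compact_lt (phi := -%R \o 'd F (y 0) \o Phi)) => // [zu|u Uu].
    apply: continuous_comp; first exact: Phi_cont.
    by apply: continuousN; exact: diff_continuous.
  by rewrite /= ltrN2 (lt_le_trans _ (dF_ge u Uu)) //; lra.
have velocities_near_y0 : \forall z \near y 0, forall u, U u ->
    `|Phi (z, u)| <= M /\ c / 2 <= 'd F (y 0) (Phi (z, u)).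
  near=> z => u Uu; split; first by apply: ltW; move: u Uu; near: z.
  by rewrite -lerN2; apply: ltW; move: u Uu; near: z.
near (0 : R)^'+ => T'.
have velocities_near t : 0 <= t <= T' -> forall u, U u ->
    `|Phi (y t, u)| <= M /\ c / 2 <= 'd F (y 0) (Phi (y t, u)).
  move: t; near: T'.
  by move/(abs_continuous_near_right T0 yac): velocities_near_y0.
have T'T : T' <= T by near: T'; exact: nbhs_right_le.
have yacT' : abs_continuous 0 T' y by exact: (abs_continuousS (lexx 0) T'T yac).
have F_lt : \forall t \near (0 : R)^'+, F (y 0) < F (y t).
  apply: (differentiable_lt_along_curve (c := c / 2) (M := M) _ yacT') => //.
    exact: divr_gt0.
  apply: ae_subset y' => t y't /andP[t0 tT'].
  have [|u Uu yu] := y't; first by rewrite t0 (le_trans tT').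
  exists (Phi (y t, u)) => //.
  by apply: velocities_near => //; rewrite t0.
near (0 : R)^'+ => t.
have : F (y 0) < F (y t) by near: t.
rewrite ltNge F_le //.
apply/andP; split; first exact: ltW.
by near: t; exact: nbhs_right_le.
Unshelve. all: by end_near. Qed.

Lemma cvg_mx (T : Type) (F : set_system T) (X : topologicalType) (m n : nat)
    (A : T -> 'M[X]_(m, n)) (A0 : 'M[X]_(m, n)) : Filter F ->
  (forall i j, A t i j @[t --> F] --> A0 i j) -> A t @[t --> F] --> A0.
Proof.
move=> FF AA0 S [P A0P PS].
have : \forall t \near F, forall i j, P i j (A t i j).
  by do 2!apply: filter_forall => ?; exact/AA0/A0P.
by apply: filterS => t /PS.
Qed.

Lemma cvg_mulmx (T : Type) (F : set_system T) (R : numFieldType) (m n p : nat)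
    (A : T -> 'M[R]_(m, n)) (B : T -> 'M[R]_(n, p)) (A0 : 'M[R]_(m, n))
    (B0 : 'M[R]_(n, p)) : Filter F ->
  A t @[t --> F] --> A0 -> B t @[t --> F] --> B0 ->
  A t *m B t @[t --> F] --> A0 *m B0.
Proof.
move=> FF AA0 BB0; apply: cvg_mx => i k.
under eq_fun do rewrite mxE; rewrite mxE.
apply: cvg_big => [|j _]; first exact: add_continuous.
apply: cvgM.
- exact: (cvg_comp A (fun M => M i j) AA0 (@coord_continuous _ _ _ i j A0)).
- exact: (cvg_comp B (fun M => M j k) BB0 (@coord_continuous _ _ _ j k B0)).
Qed.

Lemma Ck_continuous (R : realType) (V W : normedModType R) k (F : V -> W) :
  Ck k F -> continuous F.
Proof.
by case: k => [//|k [F_diff _]] x; exact: differentiable_continuous.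
Qed.

Lemma control_affine_continuous (R : realType) (n m : nat)
    (f : 'cV[R]_n -> 'cV[R]_n) (g : 'cV[R]_n -> 'M[R]_(n, m)) :
  continuous f -> continuous g ->
  continuous (fun zu : 'cV[R]_n * 'cV[R]_m => f zu.1 + g zu.1 *m zu.2).
Proof.
move=> f_cont g_cont [z u]; apply: cvgD.
  by apply: continuous_comp; [exact: cvg_fst | exact: f_cont].
apply: cvg_mulmx; last exact: cvg_snd.
by apply: continuous_comp; [exact: cvg_fst | exact: g_cont].
Qed.

Lemma negligible_shift (R : realType) (a : R) (N : set R) :
  (@lebesgue_measure R).-negligible N ->
  (@lebesgue_measure R).-negligible (shift a @^-1` N).
Proof.
move=> [A [mA A0 NA]].
pose tr : measurableTypeR R -> measurableTypeR R := shift a.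
have mtr : measurable_fun setT tr.
  apply: continuous_measurable_fun => t.
  by apply: cvgD; [exact: cvg_id | exact: cvg_cst].
exists (tr @^-1` A); split; last by move=> t /NA.
  by rewrite -[_ @^-1` _]setTI; exact: mtr.
rewrite -[LHS]/(pushforward (@lebesgue_measure R) tr A) -A0.
apply/esym/lebesgue_measure_unique; last exact: mA.
move=> /= _ [[u v]] _ <-; rewrite /pushforward.
have -> : tr @^-1` `]u, v]%classic = `]u - a, v - a]%classic.
  by apply/seteqP; split => t /=; rewrite !in_itv /= /tr ltrBlDr lerBrDr.
rewrite !lebesgue_measure_itv /= !lte_fin ltrD2r.
by case: ifP => // _; rewrite -!EFinB; congr EFin; lra.
Qed.

Lemma abs_continuous_shift (R : realType) (V : normedModType R) (a b c : R)
    (y : R -> V) : abs_continuous (a + c) (b + c) y ->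
  abs_continuous a b (y \o shift c).
Proof.
move=> yac e e0; have [d d0 yd] := yac e e0; exists d => // N s t st dis std.
apply: (yd N (shift c \o s) (shift c \o t)) => /=.
- by move=> i; rewrite !lerD2r.
- move=> i j _ _ [z [/= zi zj]]; apply: dis => //; exists (z - c).
  by move: zi zj; rewrite /= !in_itv /= !ltrBrDr !ltrBlDr.
- by under eq_bigr do rewrite opprD addrACA subrr addr0.
Qed.

Lemma is_derive_comp_shift (R : numFieldType) (V W : normedModType R)
    (c t v : V) (y : V -> W) (w : W) :
  is_derive (t + c) v y w -> is_derive t v (y \o shift c) w.
Proof.
have shiftE : (fun h : R => h^-1 *: ((y \o shift c \o shift t) (h *: v) -
    (y \o shift c) t)) =
    (fun h => h^-1 *: ((y \o shift (t + c)) (h *: v) - y (t + c))).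
  by apply/funext => h /=; rewrite addrA.
by move=> [dy yw]; split; [rewrite /derivable|rewrite /derive]; rewrite shiftE.
Qed.

Section flow_theory.
Context {R : realType} {n : nat}.
Variables (F : 'cV[R]_n -> 'cV[R]_n) (h : 'cV[R]_n -> R).
Implicit Types (x : 'cV[R]_n) (y : R -> 'cV[R]_n) (c s t : R).

Lemma is_solution_shift x y c : 0 <= c ->
  is_solution F x y -> is_solution F (y c) (y \o shift c).
Proof.
move=> c0 [y0 yac yae]; split; first by rewrite /= add0r.
- move=> T T0; apply: abs_continuous_shift; rewrite add0r.
  by apply: (abs_continuousS c0 (lexx _)); apply: yac; rewrite ltr_wpDr.
- apply: negligibleS (negligible_shift c yae) => t /= yt.
  apply: contra_not yt => yt t0; apply: is_derive_comp_shift.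
  by apply: yt; rewrite addr_ge0.
Qed.

Lemma flow_is_solution x :
  has_unique_solution F x -> is_solution F x (flow F x).
Proof. by move=> [y Fy _]; rewrite /flow; apply: xgetPex; exists y. Qed.

Lemma flow0 x : has_unique_solution F x -> flow F x 0 = x.
Proof. by move=> /flow_is_solution[]. Qed.

Lemma flow_add x s t : has_unique_solution F x ->
  has_unique_solution F (flow F x t) -> 0 <= s -> 0 <= t ->
  flow F (flow F x t) s = flow F x (s + t).
Proof.
move=> Fx Fxt s0 t0; have [y _ y_uniq] := Fxt.
rewrite (y_uniq _ (flow_is_solution Fxt) s s0).
by rewrite -(y_uniq _ (is_solution_shift t0 (flow_is_solution Fx)) s s0).
Qed.

Lemma psi_le_Hfun x t : Hdom h F x -> 0 <= t -> psi h F t x <= Hfun h F x.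
Proof. by move=> [_ [_ ub]] t0; apply: ub_le_sup => //; exists t. Qed.

Lemma Hfun_flow_le x t : Hdom h F x ->
  has_unique_solution F (flow F x t) -> 0 <= t ->
  Hfun h F (flow F x t) <= Hfun h F x.
Proof.
move=> Hx Fxt t0; apply: ge_sup.
  by exists (psi h F 0 (flow F x t)); exists 0 => //=.
move=> _ [s /= s0 <-]; rewrite /psi flow_add //; last by case: Hx.
by apply: psi_le_Hfun => //; rewrite addr_ge0.
Qed.

End flow_theory.

Lemma gradient_mulmx (R : realType) (n : nat) (phi : 'cV[R]_n -> R)
    (x v : 'cV[R]_n) : (gradient phi x *m v) 0 0 = 'd phi x v.
Proof.
rewrite [in RHS](matrix_sum_delta v) linear_sum /= mxE.
by apply: eq_bigr => i _; rewrite big_ord1 linearZ /= mxE mulrC.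
Qed.

Lemma zeroing_CBF_of_descent (R : realType) (n m : nat)
    (f : 'cV[R]_n -> 'cV[R]_n) (g : 'cV[R]_n -> 'M[R]_(n, m))
    (U : set 'cV[R]_m) (C : set 'cV[R]_n) (H : 'cV[R]_n -> R) :
  (forall x, C x -> H x <= 0) ->
  (forall x (c : R), C x -> 0 < c ->
    exists2 u, U u & 'd H x (f x + g x *m u) < c) ->
  zeroing_CBF f g U C H.
Proof.
move=> H_le0 H_descent; exists id; first by split => // s t.
move=> x Cx; apply/lee_addgt0Pr => e e0; rewrite add0e.
have [u Uu ue] := H_descent x e Cx e0.
apply: le_trans (ereal_inf_lbound _) _; first by exists u.
rewrite lee_fin /Lf /Lg -mulmxA !gradient_mulmx opprK -linearD /=.
by have := H_le0 x Cx; lra.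
Qed.

Lemma Hfun_exists_descent (R : realType) (n m : nat) (U : set 'cV[R]_m)
    (f : 'cV[R]_n -> 'cV[R]_n) (g : 'cV[R]_n -> 'M[R]_(n, m))
    (h : 'cV[R]_n -> R) (ustar : 'cV[R]_n -> 'cV[R]_m) (x : 'cV[R]_n) (c : R) :
  let F := closed_loop f g ustar in
  compact U -> continuous f -> continuous g -> (forall z, U (ustar z)) ->
  Hdom h F x -> (forall t : R, 0 <= t -> has_unique_solution F (flow F x t)) ->
  differentiable (Hfun h F) x -> 0 < c ->
  exists2 u, U u & 'd (Hfun h F) x (f x + g x *m u) < c.
Proof.
move=> F U_compact f_cont g_cont ustar_U Hx Fx dH c0.
have [flow_x0 flow_ac flow_ae] := flow_is_solution Hx.1.
apply: (exists_descent_velocity (control_affine_continuous f_cont g_cont)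
  U_compact dH ltr01 flow_x0 (flow_ac 1 ltr01)) => //.
- apply: ae_subset flow_ae => t flow' /andP[t0 _].
  by exists (ustar (flow F x t)); [exact: ustar_U | exact: flow'].
- by move=> t /andP[t0 _]; apply: Hfun_flow_le => //; exact: Fx.
Qed.

Theorem theorem1 (R : realType) (n m r : nat) (U : set 'cV[R]_m)
  (f : 'cV[R]_n -> 'cV[R]_n) (g : 'cV[R]_n -> 'M[R]_(n, m))
  (h : 'cV[R]_n -> R) (ustar : 'cV[R]_n -> 'cV[R]_m)
  (r_ge1 : (1 <= r)%N)
  (U_compact : compact U)
  (f_Cr : Ck r f) (g_Cr : Ck r g)
  (h_reldeg : relative_degree f g r h)
  (ustar_U : forall x, U (ustar x))
  (A1 : forall x, h x <= 0 -> has_unique_solution (closed_loop f g ustar) x)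
  (A2 : forall x, h x <= 0 ->
     Hdom h (closed_loop f g ustar) x /\
     H_differentiable h (closed_loop f g ustar) x)
  (SH_neq0 : SH h (closed_loop f g ustar) !=set0) :
  zeroing_CBF f g U (SH h (closed_loop f g ustar))
    (Hfun h (closed_loop f g ustar)).
Proof.
apply: zeroing_CBF_of_descent => [x [] //|x c [Hx Hx0] c0].
have h_flow_le0 t : 0 <= t -> h (flow (closed_loop f g ustar) x t) <= 0.
  by move=> t0; apply: le_trans Hx0; exact: psi_le_Hfun.
have [_ [_ dH]] : Hdom h (closed_loop f g ustar) x /\
    H_differentiable h (closed_loop f g ustar) x.
  by apply: A2; rewrite -{1}(flow0 Hx.1) h_flow_le0.
apply: Hfun_exists_descent ustar_U Hx _ dH c0 => //.
- exact: Ck_continuous f_Cr.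
- exact: Ck_continuous g_Cr.
- by move=> t t0; exact/A1/h_flow_le0.
Qed.
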